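(* The following (incomparable) graph classes of bounded layered tree-independence number admit clique-based separators of sublinear weight: \begin{itemize} \item[(a)] every class of bounded layered tree-independence number with a subquadratic $\theta$-binding function; \item[(b)] every class of bounded layered treewidth; \item[(c)] every class of bounded tree-independence number. \end{itemize}
   Context: All graphs are finite and simple; $\alpha$ is the independence number and $\theta$ the clique cover number (minimum number of cliques covering all vertices). ''Incomparable'' refers to the three properties (a), (b), (c) of graph classes: of any two of them, neither implies the other. A separation of $G$ is a pair $(A,B)$ of subsets of $V(G)$ with $A\cup B=V(G)$ and no edge between $A\setminus B$ and $B\setminus A$; it is $\beta$-balanced if $\max\{|A\setminus B|,|B\setminus A|\}\le\beta|V(G)|$. A clique-based separator of $G$ is a collection $\mathcal{S}$ of pairwise vertex-disjoint cliques whose union is a balanced separator, i.e. equals $A\cap B$ for a $\beta$-balanced separation $(A,B)$, for a fixed constant $\beta<1$; its weight is $\sum_{C\in\mathcal{S}}\log(|C|+1)$. A class $\mathcal{G}$ admits clique-based separators of sublinear weight if there are a constant $\beta<1$ and a function $w(n)=o(n)$ such that every $n$-vertex graph in $\mathcal{G}$ has a clique-based separator (with balance constant $\beta$) of weight at most $w(n)$. A $\theta$-binding function for $\mathcal{G}$ is a function $f$ such that $\theta(H)\le f(\alpha(H))$ for every $G\in\mathcal{G}$ and every induced subgraph $H$ of $G$; it is subquadratic if $f(x)=o(x^2)$. A tree decomposition of $G$ is a pair $(T,\{X_t\}_{t\in V(T)})$ with $T$ a tree and bags $X_t\subseteq V(G)$ such that every vertex is in some bag, both endpoints of every edge lie in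 a common bag, and for each $u\in V(G)$ the nodes $t$ with $u\in X_t$ induce a connected subgraph of $T$. The tree-independence number of $G$ is the minimum over tree decompositions of $\max_t\alpha(G[X_t])$. A layering of $G$ is an ordered partition $(V_0,V_1,\ldots)$ of $V(G)$ (parts may be empty, all but finitely many are) such that for each edge $uv$ with $u\in V_i$, $v\in V_j$ we have $|i-j|\le1$. The layered treewidth (resp. layered tree-independence number) of $G$ is the minimum $\ell$ such that there are a tree decomposition and a layering of $G$ with $|X_t\cap V_i|\le\ell$ (resp. $\alpha(G[X_t\cap V_i])\le\ell$) for every bag $X_t$ and layer $V_i$. A class has one of these parameters bounded if some constant bounds the parameter for all its graphs.
   Formalization: The claim that (b) does not imply (a) is omitted because it is false: layered treewidth at most k gives chromatic number at most 2k, hence the linear θ-binding function 2kx; the other five non-implications are stated. *)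

(* Defs.v *)
From mathcomp Require Import all_boot all_order all_algebra.
From mathcomp Require Import all_classical all_reals all_analysis.
Set Implicit Arguments.
Unset Strict Implicit.
Unset Printing Implicit Defensive.
Import Order.TTheory GRing.Theory Num.Theory numFieldNormedType.Exports.

Record sgraph := SGraph {
  vert :> finType;
  edge : rel vert;
  edge_sym : symmetric edge;
  edge_irr : irreflexive edge }.

(* Not required to be closed under isomorphism or induced subgraphs. *)
Definition graph_class := sgraph -> Prop.

Section Induced.
Variables (G : sgraph) (U : {set G}).

Definition induced_edge : rel {x : G | x \in U} :=
  fun x y => edge (val x) (val y).

Lemma induced_edge_sym : symmetric induced_edge.
Proof. by move=> x y; apply: edge_sym. Qed.

Lemma induced_edge_irr : irreflexive induced_edge.
Proof. by move=> x; apply: edge_irr. Qed.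

Definition induced_subgraph : sgraph := SGraph induced_edge_sym induced_edge_irr.

End Induced.

Section GraphInvariants.
Variable G : sgraph.

Definition clique (S : {set G}) : bool :=
  [forall x in S, forall y in S, (x != y) ==> edge x y].

Definition stable (S : {set G}) : bool :=
  [forall x in S, forall y in S, ~~ edge x y].

Definition alpha : nat := \max_(S : {set G} | stable S) #|S|.

Definition clique_cover (P : {set {set G}}) : bool :=
  [forall C in P, clique C] && (finset.cover P == [set: G]).

Definition singletons : {set {set G}} := [set [set x] | x : G].

Lemma singletons_clique_cover : clique_cover singletons.
Proof.
apply/andP; split.
  apply/forall_inP => C /imsetP[x _ ->].
  apply/forall_inP => y /set1P->; apply/forall_inP => z /set1P->.
  by rewrite eqxx.
apply/eqP/setP => x; rewrite inE; apply/bigcupP.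
by exists [set x]; rewrite ?inE //; apply/imsetP; exists x.
Qed.

(* Minimum of #|P| over all clique covers P; [singletons] only witnesses that
   clique covers exist. *)
Definition theta : nat :=
  #|[arg min_(P < singletons | clique_cover P) #|P|]|.

Definition connected_graph : Prop := forall x y : G, connect (@edge G) x y.

Definition acyclic : Prop :=
  forall c : seq G, (2 < size c)%N -> ~ ucycle (@edge G) c.

Definition is_tree : Prop := [/\ (0 < #|G|)%N, connected_graph & acyclic].

End GraphInvariants.

Definition tree_decomposition (G T : sgraph) (X : T -> {set G}) : Prop :=
  [/\ is_tree T,
      forall u : G, exists t : T, u \in X t,
      forall u v : G, edge u v -> exists t : T, (u \in X t) && (v \in X t)
    & forall u : G, connected_graph (induced_subgraph [set t : T | u \in X t])].

(* A layering (V_0, V_1, ...) is encoded by the function sending each vertex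
   to the index of its part. *)
Definition layering (G : sgraph) (l : G -> nat) : Prop :=
  forall u v : G, edge u v -> (l u <= (l v).+1)%N && (l v <= (l u).+1)%N.

Definition layer (G : sgraph) (l : G -> nat) (i : nat) : {set G} :=
  [set v | l v == i].

Definition tree_alpha_le (G : sgraph) (k : nat) : Prop :=
  exists (T : sgraph) (X : T -> {set G}),
    tree_decomposition X /\ forall t : T, (alpha (induced_subgraph (X t)) <= k)%N.

Definition layered_tree_alpha_le (G : sgraph) (k : nat) : Prop :=
  exists (T : sgraph) (X : T -> {set G}) (l : G -> nat),
    [/\ tree_decomposition X, layering l
      & forall (t : T) (i : nat),
          (alpha (induced_subgraph (X t :&: layer l i)%SET) <= k)%N].

(* Bags are measured by cardinality, without the -1 used for treewidth. *)
Definition layered_tw_le (G : sgraph) (k : nat) : Prop :=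
  exists (T : sgraph) (X : T -> {set G}) (l : G -> nat),
    [/\ tree_decomposition X, layering l
      & forall (t : T) (i : nat), (#|(X t :&: layer l i)%SET| <= k)%N].

Section Existence.
Variable G : sgraph.

Definition point_graph : sgraph :=
  @SGraph unit (fun _ _ => false) (fun _ _ => erefl) (fun _ => erefl).

Lemma trivial_tree_decomposition :
  @tree_decomposition G point_graph (fun _ => [set: G]).
Proof.
split.
- split; first by rewrite card_unit.
    by move=> [] []; apply: connect0.
  by move=> [|x [|y c]] //= _ [] /=.
- by move=> u; exists tt; rewrite inE.
- by move=> u v _; exists tt; rewrite !inE.
- by move=> u x y; rewrite (_ : x = y) ?connect0 //; apply: val_inj;
    case: (val x); case: (val y).
Qed.

Lemma trivial_layering : @layering G (fun _ => 0%N).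
Proof. by []. Qed.

Lemma alpha_le_card (H : sgraph) : (alpha H <= #|H|)%N.
Proof. by apply/bigmax_leqP => S _; apply: max_card. Qed.

Lemma alpha_induced_le (U : {set G}) : (alpha (induced_subgraph U) <= #|G|)%N.
Proof.
by apply: (leq_trans (alpha_le_card _)); rewrite card_sig; apply: max_card.
Qed.

Lemma tree_alpha_ex : exists k, `[< tree_alpha_le G k >].
Proof.
exists #|G|; apply/asboolP; exists point_graph, (fun _ => [set: G]).
by split=> [|t]; [apply: trivial_tree_decomposition | apply: alpha_induced_le].
Qed.

Lemma layered_tree_alpha_ex : exists k, `[< layered_tree_alpha_le G k >].
Proof.
exists #|G|; apply/asboolP; exists point_graph, (fun _ => [set: G]), (fun _ => 0%N).
split; first exact: trivial_tree_decomposition.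
  exact: trivial_layering.
by move=> t i; apply: alpha_induced_le.
Qed.

Lemma layered_tw_ex : exists k, `[< layered_tw_le G k >].
Proof.
exists #|G|; apply/asboolP; exists point_graph, (fun _ => [set: G]), (fun _ => 0%N).
split; first exact: trivial_tree_decomposition.
  exact: trivial_layering.
by move=> t i; apply: max_card.
Qed.

Definition tree_alpha : nat := ex_minn tree_alpha_ex.
Definition layered_tree_alpha : nat := ex_minn layered_tree_alpha_ex.
Definition layered_tw : nat := ex_minn layered_tw_ex.

End Existence.

Definition bounded_on (p : sgraph -> nat) (C : graph_class) : Prop :=
  exists k : nat, forall G : sgraph, C G -> (p G <= k)%N.

Local Open Scope ring_scope.

Section Separators.
Variable R : realType.

Definition separation (G : sgraph) (A B : {set G}) : Prop :=
  (A :|: B)%SET = [set: G] /\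
  forall x y : G, x \in A :\: B -> y \in B :\: A -> ~~ edge x y.

Definition balanced (G : sgraph) (beta : R) (A B : {set G}) : Prop :=
  (maxn #|A :\: B| #|B :\: A|)%:R <= beta * #|G|%:R.

Definition clique_based_separator (G : sgraph) (beta : R)
    (S : {set {set G}}) : Prop :=
  [/\ finset.trivIset S,
      forall K : {set G}, K \in S -> clique K
    & exists A B : {set G},
        [/\ separation A B, balanced beta A B & finset.cover S = A :&: B]].

(* Natural logarithm; another base only rescales the weight by a constant. *)
Definition weight (G : sgraph) (S : {set {set G}}) : R :=
  \sum_(K in S) ln (#|K|.+1)%:R.

Definition sublinear_clique_based_separators (C : graph_class) : Prop :=
  exists beta : R, beta < 1 /\
  exists w : nat -> R,
    w =o_ eventually (fun n : nat => n%:R : R) /\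
    forall G : sgraph, C G ->
      exists S : {set {set G}},
        clique_based_separator beta S /\ weight S <= w #|G|.

Definition theta_binding (C : graph_class) (f : nat -> R) : Prop :=
  forall G : sgraph, C G ->
  forall U : {set G}, (theta (induced_subgraph U))%:R <= f (alpha (induced_subgraph U)).

Definition has_subquadratic_theta_binding (C : graph_class) : Prop :=
  exists f : nat -> R,
    theta_binding C f /\ f =o_ eventually (fun x : nat => x%:R ^+ 2 : R).

Definition property_a (C : graph_class) : Prop :=
  bounded_on layered_tree_alpha C /\ has_subquadratic_theta_binding C.

End Separators.

Definition property_b (C : graph_class) : Prop := bounded_on layered_tw C.

Definition property_c (C : graph_class) : Prop := bounded_on tree_alpha C.

(* Pitfall: [class_implies property_b (property_a R)] holds, so these three
   properties are not pairwise incomparable. If the layered treewidth is at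
   most k, each layer has treewidth less than k, so colouring even and odd
   layers with disjoint palettes gives chromatic number at most 2k. Hence
   theta H <= #|H| <= 2k * alpha H for every induced subgraph H, a linear
   theta-binding function. The other five implications fail. *)
Definition class_implies (P Q : graph_class -> Prop) : Prop :=
  forall C : graph_class, P C -> Q C.

(* Main.v *)
(* Bounded layered tree-independence number alone forces clique-based separators
   of sublinear weight.  A singleton has weight log 2, so any o(n) vertices may
   be put in the separator for free: delete every d-th layer, at most n/d
   vertices.  If one of the remaining chunks of d - 1 layers is still large,
   split it by a bag whose removal from the whole graph leaves components of
   size at most n/2; inside the chunk the bag has independence number at most
   dk.  By Ramsey's theorem all but a constant number of the vertices of such a
   set are covered by disjoint cliques of size q, each of weight log (q + 1),
   which costs at most (n/q) log (q + 1) + O(1).  Let d and q grow.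

   Complete graphs separate (a) and (c) from (b), grids separate (a) and (b)
   from (c), and the complements of shift graphs, which have independence number
   at most 2 and unbounded clique cover number, separate (c) from (a). *)
Require Import Defs.
From mathcomp Require Import all_boot all_order all_algebra.
From mathcomp Require Import boolp classical_sets topology landau normedtype.
From mathcomp Require Import sequences exp reals fintype finset zify lra.
Set Implicit Arguments.
Unset Strict Implicit.
Unset Printing Implicit Defensive.
Import Order.TTheory GRing.Theory Num.Theory numFieldNormedType.Exports.

Local Open Scope nat_scope.

(** * Components of a graph with a vertex set deleted *)

Section Components.
Variable G : sgraph.
Implicit Types (Y U : {set G}) (x y v : G).

(** Adjacency in [G - Y], kept as a relation on all of [G] to avoid subtypes. A vertex of [Y] is a
    component of its own, hence the later side conditions [v \notin Y]. *)
Definition deleted Y : rel G := fun x y =>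
  [&& edge x y, x \notin Y & y \notin Y].

Definition component Y v : {set G} := [set u | connect (deleted Y) v u].

Lemma deleted_sym Y : symmetric (deleted Y).
Proof. by move=> x y; rewrite /deleted edge_sym andbCA andbC andbA. Qed.

Lemma component_subset Y (P : G -> Prop) v :
  P v -> (forall x y, deleted Y x y -> P x -> P y) ->
  forall u, u \in component Y v -> P u.
Proof.
move=> Pv stepP u; rewrite inE => /connectP[p].
elim: p v Pv => [|w p IHp] v Pv /=; first by move=> _ ->.
by move=> /andP[vw wp]; apply: IHp => //; apply: stepP vw Pv.
Qed.

Lemma component_disjoint Y v u :
  v \notin Y -> u \in component Y v -> u \notin Y.
Proof.
move=> vY; apply: (component_subset (P := fun u => u \notin Y)) => //.
by move=> x y /and3P[].
Qed.

Lemma path_deleted Y x p :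
  path (@edge G) x p -> all (fun y => y \notin Y) (x :: p) ->
  path (deleted Y) x p.
Proof.
elim: p x => //= y p IHp x /andP[xy yp] /and3P[xY yY pY].
by rewrite /deleted xy xY yY IHp //= yY.
Qed.

Lemma connect_induced U (r : rel G) (x y : induced_subgraph U) :
  {in U &, forall a b, edge a b -> r a b} ->
  connect (@edge (induced_subgraph U)) x y -> connect r (val x) (val y).
Proof.
move=> sub /connectP[p]; elim: p x => [|z p IHp] x /=; first by move=> _ ->.
move=> /andP[xz zp] lst; apply: (connect_trans _ (IHp z zp lst)).
by apply/connect1/sub => //; apply: valP.
Qed.

End Components.

(** * Consequences of acyclicity *)

Section Trees.
Variable T : sgraph.

(** Iterating [phi] runs into a loop of distinct vertices. Acyclicity bounds its length by 2, and
    irreflexivity excludes length 1. *)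
Lemma acyclic_backtrack (phi : T -> T) (x0 : T) :
  acyclic T -> (forall t, edge t (phi t)) -> exists t, phi (phi t) = t.
Proof.
move=> acT phiE.
have /trajectP[i lti loop] := looping_order phi x0.
pose y := iter i phi x0.
have: fcycle phi (orbit phi y).
  apply/(orbitPcycle 0 3); exists (order phi x0 - i).-1.
  by rewrite prednK ?subn_gt0 // -iterD subnK ?loop // ltnW.
move=> cy; exists y.
have szle : size (orbit phi y) <= 2.
  rewrite leqNgt; apply/negP => /acT; apply; apply/andP; split.
    by apply: sub_cycle cy => a b /eqP <-.
  exact: orbit_uniq.
have := (orbitPcycle 0 4).1 cy; have := order_gt0 phi y;
  rewrite size_orbit in szle.
case: (order phi y) szle => [|[|[|n]]] //= _ _ fy.
by have := phiE y; rewrite fy edge_irr.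
Qed.

Lemma neighbour_towards (t s : T) :
  connected_graph T -> s != t ->
  exists t', edge t t' && connect (deleted [set t]) t' s.
Proof.
move=> cT; have /connectP[p tp ->] := cT t s.
case: (shortenP tp) => -[|t' q] /=; first by rewrite eqxx.
move=> /andP[tt' qE] /and3P[tq t'q uq] _ _.
exists t'; rewrite tt' /=; apply/connectP; exists q => //.
apply: path_deleted => //; apply/allP => z zq; rewrite inE.
by apply: contraNneq tq => <-.
Qed.

(** Both walks would survive the removal of the edge [t t'], since each avoids one of its ends. A
    simple path would then join [t] to [t'] without this edge, which closes it to a cycle. *)
Lemma acyclic_sides_disjoint (t t' s : T) :
  acyclic T -> edge t t' ->
  connect (deleted [set t]) t' s -> ~ connect (deleted [set t']) t s.
Proof.
move=> acT tt' t's ts.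
pose e : rel T := fun x y =>
  edge x y && ~~ [|| (x == t) && (y == t') | (x == t') && (y == t)].
have eS : connect_sym e.
  apply: sym_connect_sym => x y; rewrite /e edge_sym; congr (_ && ~~ _).
  by rewrite orbC; congr (_ || _); rewrite andbC.
have se (z : T) : z \in [:: t; t'] -> forall x y,
  connect (deleted [set z]) x y -> connect e x y.
  move=> zt; apply: connect_sub => x y /and3P[xy]; rewrite !inE => xz yz.
  apply/connect1; rewrite /e xy /=; apply/negP.
  move: zt; rewrite !inE => /orP[]/eqP zE; subst z;
    by move=> /orP[]/andP[/eqP xE /eqP yE]; subst x y; rewrite eqxx in xz yz.
have : connect e t t'.
  apply: (@connect_trans _ _ s); first by apply: (se t');
    rewrite ?inE ?eqxx ?orbT.
  by rewrite eS; apply: (se t); rewrite ?inE ?eqxx.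
move=> /connectP[p tp t'E]; move: tp t'E => /shortenP[q tq uq _ t'E].
have lst : last t q = t' by [].
(* Length 0 means [t = t'], and length 1 would use the removed edge; any longer path gives a cycle
   on at least three vertices. *)
case: q tq uq {t'E} lst => [|x q] tq uq lst.
  by move: tt'; rewrite -lst edge_irr.
case: q tq uq lst => [|y q] tq uq lst.
  by move: tq lst => /=; rewrite /e => /andP[/andP[_ xE] _] xt';
    rewrite xt' !eqxx in xE.
apply: (acT [:: t, x, y & q]) => //; rewrite /ucycle uq andbT.
rewrite (cycle_path t) /=; rewrite /= in lst; rewrite lst edge_sym tt' /=.
by apply: (sub_path _ tq) => a b /andP[].
Qed.

End Trees.

(** * Centroid bags of tree decompositions *)

Section Centroid.
Variables (G T : sgraph) (X : T -> {set G}).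
Hypothesis XP : tree_decomposition X.

Lemma bags_connected v t s s' :
  v \notin X t -> v \in X s -> v \in X s' -> connect (deleted [set t]) s s'.
Proof.
move=> vt vs vs'; have [_ _ _ /(_ v) cv] := XP.
have sI : s \in [set t | v \in X t] by rewrite inE.
have s'I : s' \in [set t | v \in X t] by rewrite inE.
apply: (connect_induced _ (cv (exist _ s sI) (exist _ s' s'I))) => a b.
rewrite !inE => va vb ab; rewrite /deleted ab !inE /=.
by apply/andP; split; [apply: contraNneq vt => <-|apply: contraNneq vt => <-].
Qed.

(** Adjacent vertices share a bag, and the bags of a vertex outside [X t] form a connected set of
    nodes missing [t]; so the bags met by a component of [G - X t] stay on one side of [t]. *)
Lemma component_bags_connected v t u s s' :
  v \notin X t -> u \in component (X t) v -> v \in X s -> u \in X s' ->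
  connect (deleted [set t]) s s'.
Proof.
move=> vt uv vs; have [_ _ eX _] := XP.
move: u uv s'; apply: component_subset =>
  [s' vs'|x y /and3P[xy xt yt] IH s' ys'].
  exact: bags_connected vs vs'.
have [r /andP[xr yr]] := eX _ _ xy.
exact: connect_trans (IH _ xr) (bags_connected yt yr ys').
Qed.

(* Otherwise every node points to the neighbour in the direction of its big
   component; by acyclicity two adjacent nodes point to each other, and their
   big components, lying on opposite sides, cannot intersect. *)
Theorem centroid_bag :
  exists t, forall v, v \notin X t -> 2 * #|component (X t) v| <= #|G|.
Proof.
have [[T0 cT acT] vX eX _] := XP.
apply: contrapT => nt.
have big t : exists v, (v \notin X t) && (#|G| < 2 * #|component (X t) v|).
  apply: contrapT => nv; apply: nt; exists t => v vt; rewrite leqNgt.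
  by apply/negP => vb; apply: nv; exists v; rewrite vt.
have nb t : exists t', edge t t' /\ exists v, [/\ v \notin X t,
    #|G| < 2 * #|component (X t) v| &
    forall u s, u \in component (X t) v -> u \in X s ->
      connect (deleted [set t]) t' s].
  have [v /andP[vt vb]] := big t; have [s vs] := vX v.
  have st : s != t by apply: contraNneq vt => <-.
  have [t' /andP[tt' t's]] := neighbour_towards cT st.
  exists t'; split => //; exists v; split => // u r uv ur.
  exact: connect_trans t's (component_bags_connected vt uv vs ur).
have [phi phiP] := choice nb.
have /card_gt0P[x0 _] := T0.
have [t tE] := acyclic_backtrack x0 acT (fun t => (phiP t).1).
have [tt' [v [vt vb vs]]] := phiP t.
have [_ [v' [vt' vb' vs']]] := phiP (phi t).
(* Two sets that each contain more than half of the vertices must meet. *)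
have /set0Pn[u] : component (X t) v :&: component (X (phi t)) v' != set0.
  apply: contraTneq vb => I0.
  have := cardsUI (component (X t) v) (component (X (phi t)) v').
  have : #|component (X t) v :|: component (X (phi t)) v'| <= #|G|.
    exact: max_card.
  rewrite I0 cards0 -leqNgt; lia.
rewrite in_setI => /andP[uv uv']; have [s us] := vX u.
have := vs' _ _ uv' us; rewrite tE.
exact: acyclic_sides_disjoint acT tt' (vs _ _ uv us).
Qed.

End Centroid.

(** * Balanced separations and Ramsey's theorem *)

Section Combinatorics.
Variable G : sgraph.
Implicit Types (Y U S K : {set G}) (v : G).

Lemma cliqueP K : reflect {in K &, forall x y, x != y -> edge x y} (clique K).
Proof.
apply: (iffP forall_inP) => [cK x y xK yK xy|cK x xK].
  by have /forall_inP/(_ _ yK)/implyP := cK x xK; apply.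
by apply/forall_inP => y yK; apply/implyP; apply: cK.
Qed.

Lemma stableP S : reflect {in S &, forall x y, ~~ edge x y} (stable S).
Proof.
apply: (iffP forall_inP) => [sS x y xS yS|sS x xS].
  by have /forall_inP/(_ _ yS) := sS x xS.
by apply/forall_inP => y yS; apply: sS.
Qed.

Lemma stable_subset S S' : S' \subset S -> stable S -> stable S'.
Proof.
move=> /subsetP sub /stableP sS; apply/stableP => x y /sub xS /sub.
exact: sS.
Qed.

Lemma stable_leq_alpha S : stable S -> #|S| <= alpha G.
Proof.
by move=> sS; apply: (leq_bigmax_cond (F := fun S : {set G} => #|S|)).
Qed.

Lemma alpha_leqP k : reflect (forall S, stable S -> #|S| <= k) (alpha G <= k).
Proof. exact: bigmax_leqP. Qed.

(** Let [U] be a largest union of components of [G - Y] on at most 3/4 of the vertices. If a vertex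
    remains, adding its component, of size at most 1/2, exceeds 3/4; so [U] has more than 1/4 and
    the rest less than 3/4. *)
Lemma balanced_separation Y :
  (forall v, v \notin Y -> 2 * #|component Y v| <= #|G|) ->
  exists A B : {set G}, [/\ separation A B, A :&: B = Y,
    4 * #|A :\: B| <= 3 * #|G| & 4 * #|B :\: A| <= 3 * #|G|].
Proof.
move=> small.
pose closedY U := (U \subset ~: Y) &&
  [forall x, forall y, deleted Y x y ==> (x \in U) ==> (y \in U)].
have closedE U : closedY U -> forall x y, deleted Y x y -> x \in U -> y \in U.
  by move=> /andP[_ /forallP cU] x y xy xU; have /forallP/(_ y) := cU x;
    rewrite xy xU.
pose P U := closedY U && (4 * #|U| <= 3 * #|G|).
have P0 : P set0.
  rewrite /P cards0 muln0 andbT /closedY sub0set.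
  by apply/forallP => x; apply/forallP => y; rewrite !inE implybT.
case: (@arg_maxnP _ set0 P (fun U => #|U|) P0) => U /andP[cU Ule] Umax.
have UY x : x \in U -> x \notin Y.
  by move: cU => /andP[/subsetP sUY _] /sUY; rewrite inE.
exists (Y :|: U), (~: U).
have -> : (Y :|: U) :\: ~: U = U by apply/setP => x; rewrite !inE;
  case: (x \in U); rewrite ?orbT ?andbF.
have -> : ~: U :\: (Y :|: U) = ~: Y :\: U by apply/setP => x; rewrite !inE;
  case: (x \in U); rewrite ?orbT ?orbF ?andbT ?andbF.
split => //.
- split; first by apply/setP => x; rewrite !inE; case: (x \in U); rewrite ?orbT.
  move=> x y; rewrite !inE negb_or => /andP[nxU /orP[xY|xU]];
    first by rewrite negbK in nxU; rewrite (negPf (UY _ nxU)) in xY.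
  move=> /andP[/andP[yY yU] _]; apply: contra yU => xy.
  by apply: (closedE _ cU x) => //; rewrite /deleted xy yY (UY _ xU).
- by apply/setP => x; rewrite !inE;
  case: (boolP (x \in U)) => [/UY/negPf->|]; rewrite ?orbF ?andbT ?andbF.
have [->|/set0Pn[v]] := eqVneq (~: Y :\: U) set0; first by rewrite cards0.
rewrite !inE => /andP[vU vY].
have cUD : closedY (U :|: component Y v).
  apply/andP; split.
    apply/subsetP => x; rewrite in_setU in_setC => /orP[/UY //|].
    exact: component_disjoint.
  apply/forallP => x; apply/forallP => y; apply/implyP => xy; apply/implyP.
  rewrite !in_setU => /orP[/(closedE _ cU _ _ xy) ->//|].
  by rewrite !inE => vx; rewrite (connect_trans vx (connect1 xy)) orbT.
have big : 3 * #|G| < 4 * #|U :|: component Y v|.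
  rewrite ltnNge; apply/negP => le.
  have /Umax : P (U :|: component Y v) by rewrite /P cUD le.
  apply/negP; rewrite -ltnNge; apply: proper_card.
  apply/properP; split; first exact: subsetUl.
  by exists v; rewrite // !inE connect0 orbT.
have := small v vY; have := (leq_card_setU U (component Y v)).1.
have : #|~: Y :\: U| <= #|~: U|.
  by apply: subset_leq_card; rewrite setDE subsetIr.
by have := cardsC U; lia.
Qed.

(** Induction on [a + b]: a vertex [v] extends a clique among its neighbours or a stable set among
    its non-neighbours, and one of these two parts has at least half of [2 ^ (a + b)] vertices. *)
Lemma ramsey a b Y : 2 ^ (a + b) <= #|Y| ->
  (exists K, [/\ K \subset Y, clique K & #|K| = a]) \/
  (exists S, [/\ S \subset Y, stable S & #|S| = b]).
Proof.
have [n] := ubnP (a + b); elim: n a b Y => // n IHn [|a] b Y.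
  by move=> _ _; left; exists set0; rewrite sub0set cards0; split=> //;
    apply/cliqueP => x y; rewrite inE.
case: b => [|b] abn Yge.
  by right; exists set0; rewrite sub0set cards0; split=> //;
    apply/stableP => x y; rewrite inE.
have /card_gt0P[v vY] : 0 < #|Y| by apply: leq_trans Yge; rewrite expn_gt0.
pose N := [set x in Y | edge v x]; pose M := [set x in Y :\ v | ~~ edge v x].
have YE : #|Y| = (#|N| + #|M|).+1.
  rewrite (cardsD1 v) vY; congr (_.+1).
  rewrite -(cardsID [set x | edge v x] (Y :\ v)); congr (_ + _);
    apply: eq_card => x; rewrite !inE.
    by case: eqP => [->|]; rewrite ?edge_irr ?andbF.
  by rewrite andbC.
have [Nge|Nlt] := leqP (2 ^ (a + b.+1)) #|N|.
  have ltn : a + b.+1 < n by lia.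
  have [[K [KN /cliqueP cK Ka]]|[S [SN sS Sb]]] := IHn a b.+1 N ltn Nge.
    left; exists (v |: K); have vK : v \notin K.
      by apply/negP => /(subsetP KN); rewrite inE edge_irr andbF.
    split; last by rewrite cardsU1 vK Ka.
      rewrite subUset sub1set vY; apply: subset_trans KN _.
      by apply/subsetP => x; rewrite inE => /andP[].
    have vE x : x \in K -> edge v x by move=> /(subsetP KN);
      rewrite inE => /andP[].
    apply/cliqueP => x y /setU1P[->|xK] /setU1P[->|yK]; rewrite ?eqxx // => xy.
    - exact: vE.
    - by rewrite edge_sym vE.
    - exact: cK.
  right; exists S; split=> //; apply: subset_trans SN _.
  by apply/subsetP => x; rewrite inE => /andP[].
have Mge : 2 ^ (a.+1 + b) <= #|M|.
  by move: Yge Nlt; rewrite YE addSn !addnS addSn expnS; lia.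
have ltn : a.+1 + b < n by lia.
have [[K [KM cK Ka]]|[S [SM /stableP sS Sb]]] := IHn a.+1 b M ltn Mge.
  left; exists K; split=> //; apply: subset_trans KM _.
  by apply/subsetP => x; rewrite !inE => /andP[/andP[]].
right; exists (v |: S); have vS : v \notin S.
  by apply/negP => /(subsetP SM); rewrite !inE eqxx.
split; last by rewrite cardsU1 vS Sb.
  rewrite subUset sub1set vY; apply: subset_trans SM _.
  by apply/subsetP => x; rewrite !inE => /andP[/andP[]].
have vE x : x \in S -> ~~ edge v x by move=> /(subsetP SM);
  rewrite inE => /andP[].
apply/stableP => x y /setU1P[->|xS] /setU1P[->|yS]; rewrite ?edge_irr //.
- exact: vE.
- by rewrite edge_sym vE.
- exact: sS.
Qed.

End Combinatorics.

Lemma stable_induced (G : sgraph) (U S : {set G}) :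
  S \subset U -> stable S -> #|S| <= alpha (induced_subgraph U).
Proof.
move=> /subsetP SU /stableP sS.
pose S' : {set induced_subgraph U} := [set x | val x \in S].
have -> : #|S| = #|S'|.
  rewrite -(card_imset _ (@val_inj _ _ (induced_subgraph U)));
    apply: eq_card => x.
  apply/idP/imsetP => [xS|[y yS ->]]; last by rewrite inE in yS.
  by exists (exist _ x (SU x xS)); rewrite ?inE.
by apply: stable_leq_alpha; apply/stableP => x y; rewrite !inE; apply: sS.
Qed.

Lemma alpha_induced_leqP (G : sgraph) (U : {set G}) k :
  reflect (forall S : {set G}, S \subset U -> stable S -> #|S| <= k)
          (alpha (induced_subgraph U) <= k).
Proof.
apply: (iffP idP) => [le S SU sS|H];
  first exact: leq_trans (stable_induced SU sS) le.
apply/alpha_leqP => S /stableP sS.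
rewrite -(card_imset _ (@val_inj _ _ (induced_subgraph U))); apply: H.
  by apply/subsetP => _ /imsetP[y _ ->]; apply: valP.
by apply/stableP => _ _ /imsetP[x xS ->] /imsetP[y yS ->]; apply: sS.
Qed.

(** * Separation by sparse layers and a piece of a bag *)

Section LayeredSeparator.
Variables (G T : sgraph) (X : T -> {set G}) (l : G -> nat) (d k : nat).
Hypotheses (XP : tree_decomposition X) (lP : layering l) (d_gt0 : 0 < d).
Hypothesis alphaX :
  forall t i, alpha (induced_subgraph (X t :&: layer l i)) <= k.

Lemma sparse_residue :
  exists r, r < d /\ d * #|[set v | l v %% d == r]| <= #|G|.
Proof.
apply: contrapT => nr.
have big (r : 'I_d) : #|G|.+1 <= d * #|[set v | l v %% d == r]|.
  by rewrite ltnNge; apply/negP => le; apply: nr; exists r.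
have /(leq_sum _) : forall r : 'I_d,
  true -> #|G|.+1 <= d * #|[set v | l v %% d == r]| by [].
move=> /(_ (index_enum _)).
rewrite sum_nat_const card_ord -big_distrr /= leq_pmul2l //.
suff -> : \sum_(r < d) #|[set v | l v %% d == r]| = #|G| by rewrite ltnn.
rewrite -sum1_card (partition_big (fun v =>
  Ordinal (ltn_pmod (l v) d_gt0)) xpredT) //.
by apply: eq_bigr => r _; rewrite -sum1_card; apply: eq_bigl => v; rewrite inE.
Qed.

(* Deleting every layer in one residue class modulo [d] leaves chunks of fewer
   than [d] layers; only one chunk can be large, and it is split by a centroid
   bag of the whole graph. *)
Lemma layered_separator : exists W Z : {set G},
  [/\ d * #|W| <= #|G|,
      forall S : {set G}, S \subset Z -> stable S -> #|S| <= d * k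
    & forall v, v \notin W :|: Z -> 2 * #|component (W :|: Z) v| <= #|G|].
Proof.
have [r [rd Wle]] := sparse_residue.
have [t tP] := centroid_bag XP.
(* The shift by [d - r] makes the deleted layers multiples of [d], so the chunk number [c] increases
   only on entering a deleted layer. *)
pose W := [set v | l v %% d == r]; pose c v := (l v + (d - r)) %/ d.
have dW v : (d %| l v + (d - r)) = (v \in W).
  rewrite inE -[in RHS](modn_small rd) -(eqn_modDr (d - r)) subnKC ?modnn //.
  exact: ltnW.
have cE u v : edge u v -> u \notin W -> v \notin W -> c u = c v.
  wlog luv : u v / l u <= l v => [H uv uW vW|].
    have /orP[uv'|vu] := leq_total (l u) (l v); first exact: H.
    by symmetry; apply: H; rewrite // edge_sym.
  move=> /lP/andP[_ lvu] uW; have [luE|luE] : l v = l u \/ l v = (l u).+1.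
    - by lia.
    by rewrite /c luE.
  by rewrite -dW /c luE addSn divnS // => /negPf ->.
pose Q q := [set v | c v == q].
(* Two disjoint chunks cannot both exceed half of the vertices. If none does, 0 serves as an
   arbitrary choice of [q]. *)
have [q qP] : exists q, forall q', q' != q -> 2 * #|Q q'| <= #|G|.
  case: (pselect (exists q, #|G| < 2 * #|Q q|)) => [[q qb]|nq]; last first.
    by exists 0 => q' _; rewrite leqNgt; apply/negP => qb; apply: nq; exists q'.
  exists q => q' q'q; have := cardsUI (Q q) (Q q').
  have -> : Q q :&: Q q' = set0.
    by apply/setP => v; rewrite !inE; apply/negP => /andP[/eqP-> /eqP qE];
      rewrite qE eqxx in q'q.
  have : #|Q q :|: Q q'| <= #|G| by apply: max_card.
  by rewrite cards0; lia.
exists W, (X t :&: Q q); split => // [S /subsetP SZ sS|v].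
  (* Inside chunk [q] a layer is determined by its residue modulo [d]. So each of the [d] residue
     classes of [S] lies in a single layer of the bag and has at most [k] vertices. *)
  rewrite -sum1_card (partition_big (fun v =>
    Ordinal (ltn_pmod (l v) d_gt0)) xpredT) //=.
  rewrite -[X in _ <= X * _](card_ord d) -sum_nat_const; apply: leq_sum => i _.
  rewrite sum1_card; set Si := (X in #|X| <= _).
  have [v0 /andP[v0S /eqP v0i]|/eq_card0 -> //] := pickP Si.
  apply: leq_trans (alphaX t (l v0)).
  rewrite -(cardsE Si); apply: stable_induced; last first.
    by apply: stable_subset sS; apply/subsetP => v; rewrite inE => /andP[].
  apply/subsetP => v; rewrite inE => /andP[vS /eqP vi].
  have := SZ _ vS; have := SZ _ v0S;
    rewrite !inE => /andP[_ /eqP cv0] /andP[-> /eqP cv] /=.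
  have md : l v = l v0 %[mod d] by move: vi; rewrite -v0i => -[].
  have md' : l v + (d - r) = l v0 + (d - r) %[mod d] by apply/eqP;
    rewrite eqn_modDr md.
  rewrite -(eqn_add2r (d - r)) (divn_eq (l v + _) d) (divn_eq (l v0 + _) d).
  by rewrite -/(c v) -/(c v0) cv cv0 md'.
rewrite in_setU negb_or => /andP[vW vZ].
have compW u : u \in component (W :|: X t :&: Q q) v -> c u = c v.
  move: u; apply: (component_subset (P :=
    fun u => c u = c v)) => // x y /and3P[xy].
  by rewrite !in_setU !negb_or => /andP[xW _] /andP[yW _] <-; rewrite (cE x y).
(* A component never leaves its chunk. Away from chunk [q] the size of the chunk bounds it; in chunk
   [q] it lies in a component of [G - X t]. *)
have [cv|cv] := eqVneq (c v) q; last first.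
  apply: leq_trans (qP _ cv); rewrite leq_mul2l; apply/orP; right.
  by apply: subset_leq_card; apply/subsetP => u /compW cu; rewrite inE cu.
have vX : v \notin X t by move: vZ; rewrite in_setI inE cv eqxx andbT.
apply: leq_trans (tP v vX); rewrite leq_mul2l; apply/orP; right.
apply: subset_leq_card; apply/subsetP => u uC; move: (uC).
suff: forall u, u \in component (W :|: X t :&: Q q) v ->
  u \in component (X t) v /\ c u = q.
  by move=> H /H[].
move=> {u uC} u; apply: (component_subset (P :=
  fun u => u \in component (X t) v /\ c u = q)).
  by rewrite inE connect0.
move=> x y /and3P[xy]; rewrite !in_setU !negb_or =>
  /andP[xW xZ] /andP[yW yZ] [xC cx].
have cy : c y = q by rewrite -(cE x y).
split=> //; move: xC; rewrite !inE => vx; apply: connect_trans vx (connect1 _).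
move: xZ yZ; rewrite !in_setI !inE cx cy eqxx !andbT => xX yX.
by rewrite /deleted xy xX.
Qed.

End LayeredSeparator.

(** * Clique partitions of small weight *)

Section CliquePartitions.
Local Open Scope ring_scope.
Variable R : realType.

Definition clique_partition (G : sgraph) (Y : {set G}) (x : R) : Prop :=
  exists P : {set {set G}},
    [/\ trivIset P, forall K, K \in P -> clique K,
      cover P = Y & weight R P <= x].

Lemma ln_nat_ge0 n : 0 <= ln n.+1%:R :> R.
Proof. by rewrite ln_ge0 // ler1n. Qed.

Lemma weight_ge0 (G : sgraph) (P : {set {set G}}) : 0 <= weight R P.
Proof. by apply: sumr_ge0 => K _; apply: ln_nat_ge0. Qed.

Section Graph.
Variable G : sgraph.
Implicit Types (Y Z K : {set G}) (x y : R).

Lemma clique_partition_le Y x y : x <= y -> clique_partition Y x ->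
  clique_partition Y y.
Proof. by move=> xy [P [tP cP PY Px]]; exists P; split=> //;
  apply: le_trans xy. Qed.

Lemma clique_partition_union Y Z x y :
  [disjoint Y & Z] -> clique_partition Y x -> clique_partition Z y ->
    clique_partition (Y :|: Z) (x + y).
Proof.
move=> YZ [P [tP cP PY Px]] [Q [tQ cQ QZ Qy]]; exists (P :|: Q); split.
- by apply: trivIsetU; rewrite ?PY ?QZ.
- by move=> K /setUP[/cP|/cQ].
- by rewrite /cover bigcup_setU -/(cover P) -/(cover Q) PY QZ.
(* [P] and [Q] can share the empty set, so the second summand is the weight of [Q :\: P] only. *)
rewrite /weight (big_setID P) /= setUK setDUl setDv set0U lerD //.
apply: le_trans Qy; rewrite /weight [leRHS](big_setID P) /= lerDr.
by apply: sumr_ge0 => K _; apply: ln_nat_ge0.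
Qed.

Lemma clique_partition_singletons Y : clique_partition Y (#|Y|%:R * ln 2).
Proof.
have cov : cover [set [set x] | x in Y] = Y.
  by rewrite cover_imset; apply/setP => x;
    apply/bigcupP/idP => [[y yY /set1P->]|xY] //; exists x; rewrite ?inE.
exists [set [set x] | x in Y]; split=> //.
- apply/trivIsetP => _ _ /imsetP[x _ ->] /imsetP[y _ ->] xy.
  by rewrite disjoints1 inE; apply: contraNneq xy => ->.
- by move=> _ /imsetP[x _ ->]; apply/cliqueP => y z /set1P-> /set1P->;
  rewrite eqxx.
rewrite /weight big_imset /=; last by move=> ? ? _ _; apply: set1_inj.
under eq_bigr do rewrite cards1.
by rewrite sumr_const mulr_natl.
Qed.

Lemma clique_partition_clique K : clique K ->
  clique_partition K (ln #|K|.+1%:R).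
Proof.
move=> cK; exists [set K]; split; rewrite ?trivIset1 //.
- by move=> _ /set1P->.
- by rewrite /cover big_set1.
- by rewrite /weight big_set1.
Qed.

(** Greedy removal: while [2 ^ (q + k.+1)] vertices remain, Ramsey's theorem yields a clique of size
    [q], as stable sets of size [k.+1] are excluded. The leftover becomes singletons. *)
Lemma clique_partition_ramsey Y q k : (0 < q)%N ->
  (forall S : {set G}, S \subset Y -> stable S -> (#|S| <= k)%N) ->
  clique_partition Y (#|Y|%:R / q%:R * ln q.+1%:R + (2 ^ (q + k.+1))%:R * ln 2).
Proof.
move=> q0; have [n] := ubnP #|Y|; elim: n Y => // n IHn Y Yn Yk.
have ln2 : 0 <= ln 2 :> R by exact: (ln_nat_ge0 1).
have q0' : 0 < q%:R :> R by rewrite ltr0n.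
have [Yge|Ylt] := leqP (2 ^ (q + k.+1)) #|Y|; last first.
  apply: clique_partition_le (clique_partition_singletons Y);
    rewrite -[leLHS]add0r lerD //.
    by rewrite mulr_ge0 ?ln_nat_ge0 // divr_ge0.
  by rewrite ler_wpM2r // ler_nat ltnW.
have [[K [KY cK Kq]]|[S [SY sS Sk]]] := ramsey Yge; last first.
  by have := Yk S SY sS; rewrite Sk ltnn.
have YD : #|Y :\: K| = (#|Y| - q)%N by rewrite cardsD (setIidPr KY) Kq.
have qY : (q <= #|Y|)%N by rewrite -Kq subset_leq_card.
have ltn : (#|Y :\: K| < n)%N by lia.
have := IHn _ ltn (fun S SD => Yk S (subset_trans SD (subsetDl _ _))).
rewrite YD => IH.
have dis : [disjoint K & Y :\: K].
  by rewrite disjoint_sym; apply/setDidPl; rewrite setDDl setUid.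
have := clique_partition_union dis (clique_partition_clique cK) IH.
rewrite -{1}(setIidPr KY) setID; apply: clique_partition_le.
rewrite Kq natrB // mulrBl divff ?gt_eqF // addrA lerD2r.
by rewrite mulrBl mul1r addrC subrK.
Qed.

End Graph.

(** For [q = m ^ 2], [ln (q + 1) <= 2 * ln (1 + m) <= 2 * m], which is at most [e * q] once
    [m >= 2 / e]. *)
Lemma ln_nat_sublinear (e : R) : 0 < e ->
  exists q, (0 < q)%N /\ ln q.+1%:R <= e * q%:R.
Proof.
move=> e0; pose m := (Num.bound (2 / e)).+1.
have m0 : 0 < m%:R :> R by rewrite ltr0n.
exists (m ^ 2)%N; split => //.
have le : (m ^ 2).+1%:R <= (1 + m%:R) ^+ 2 :> R.
  by rewrite -natr1 natrX; nra.
apply: (@le_trans _ _ (ln ((1 + m%:R) ^+ 2 : R))).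
  by rewrite ler_ln ?posrE ?ltr0n // exprn_gt0 // addr_gt0.
rewrite lnXn ?addr_gt0 //.
have : ln (1 + m%:R) <= m%:R :> R by apply: le_ln1Dx; apply: lt_trans m0;
  rewrite ltrN10.
have em : 2 <= e * m%:R.
  rewrite mulrC -ler_pdivrMr // ltW //;
    apply: (@lt_trans _ _ (Num.bound (2 / e))%:R).
    by apply: archi_boundP; rewrite divr_ge0 // ltW.
  by rewrite ltr_nat.
by rewrite natrX -mulr_natl; nra.
Qed.

Lemma clique_partition_separator (G : sgraph) (Y : {set G}) (x : R) :
  (forall v, v \notin Y -> (2 * #|component Y v| <= #|G|)%N) ->
  clique_partition Y x ->
  exists S : {set {set G}},
    clique_based_separator (3 / 4 : R) S /\ weight R S <= x.
Proof.
move=> /balanced_separation[A [B [sAB AB lA lB]]] [S [tS cS SY Sx]].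
exists S; split=> //; split=> //; exists A, B; split=> //;
  last by rewrite SY AB.
rewrite /balanced mulrAC ler_pdivlMr // -!natrM ler_nat.
by case: (leqP #|A :\: B| #|B :\: A|) => _; lia.
Qed.

(** The budget [e] is split into thirds: singletons on the deleted layers, cliques of size [q], and
    the Ramsey leftover, whose bound [M] does not depend on [G]. *)
Lemma layered_sublinear_eps k (e : R) : 0 < e ->
  exists N, forall G, layered_tree_alpha_le G k -> (N <= #|G|)%N ->
  exists S : {set {set G}},
    clique_based_separator (3 / 4 : R) S /\ weight R S <= e * #|G|%:R.
Proof.
move=> e0; have e3 : 0 < e / 3 by rewrite divr_gt0.
have [q [q0 qP]] := ln_nat_sublinear e3.
pose d := (Num.bound (3 / e)).+1.
have dP : 1 <= d%:R * (e / 3).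
  have : 3 / e < d%:R.
    apply: (@lt_trans _ _ (Num.bound (3 / e))%:R); last by rewrite ltr_nat.
    by apply: archi_boundP; rewrite divr_ge0 // ltW.
  by rewrite ltr_pdivrMr //; lra.
pose M : R := (2 ^ (q + (d * k).+1))%:R.
exists (Num.bound (M / (e / 3))) => G [T [X [l [XP lP aX]]]] NG.
have nM : M <= #|G|%:R * (e / 3).
  rewrite -ler_pdivrMr // ltW //;
    apply: (@lt_le_trans _ _ (Num.bound (M / (e / 3)))%:R).
    by apply: archi_boundP; rewrite divr_ge0 // ltW.
  by rewrite ler_nat.
have [W [Z [Wd Zk compWZ]]] := layered_separator XP lP (ltn0Sn _ : (0 < d)%N)
  aX.
apply: clique_partition_separator compWZ _.
have dis : [disjoint W & Z :\: W].
  by rewrite disjoint_sym; apply/setDidPl; rewrite setDDl setUid.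
have Zk' (S : {set G}) : S \subset Z :\: W -> stable S -> (#|S| <= d * k)%N.
  by move=> SD; apply: Zk; apply: subset_trans SD (subsetDl _ _).
have := clique_partition_union dis (clique_partition_singletons W)
  (clique_partition_ramsey q0 Zk').
have -> : W :|: Z :\: W = W :|: Z by apply/setP => x; rewrite !inE;
  case: (x \in W).
apply: clique_partition_le.
have ln2 : ln 2 <= 1 :> R by apply: (@le_ln1Dx R 1); lra.
have ln2p : 0 <= ln 2 :> R by exact: (ln_nat_ge0 1).
have W1 : #|W|%:R * ln 2 <= e / 3 * #|G|%:R.
  apply: (@le_trans _ _ #|W|%:R); first by rewrite ler_piMr.
  have : d%:R * #|W|%:R <= #|G|%:R :> R by rewrite -natrM ler_nat.
  move=> h; apply: (@le_trans _ _ (d%:R * #|W|%:R * (e / 3))).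
    by rewrite mulrAC ler_peMl.
  by rewrite mulrC ler_wpM2l // ltW.
have Z1 : #|Z :\: W|%:R / q%:R * ln q.+1%:R <= e / 3 * #|G|%:R :> R.
  apply: (@le_trans _ _ (#|Z :\: W|%:R / q%:R * (e / 3 * q%:R))).
    by rewrite ler_wpM2l // divr_ge0.
  rewrite mulrCA divfK ?pnatr_eq0 -?lt0n // ler_wpM2l //; first exact: ltW.
  by rewrite ler_nat max_card.
have M1 : M * ln 2 <= e / 3 * #|G|%:R.
  by rewrite mulrC in nM; apply: le_trans nM; rewrite mulrC ler_piMl // ler0n.
by rewrite -/M; lra.
Qed.

(* As [w n] take the supremum, over the [n]-vertex graphs of the class, of the
   least weight of a separator. *)
Lemma sublinear_of_eps (C : graph_class) (beta : R) : 0 <= beta < 1 ->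
  (forall e : R, 0 < e -> exists N, forall G, C G -> (N <= #|G|)%N ->
    exists S : {set {set G}},
      clique_based_separator beta S /\ weight R S <= e * #|G|%:R) ->
  sublinear_clique_based_separators R C.
Proof.
move=> /andP[b0 b1] epsP.
(* The whole vertex set, cut into singletons, is always a separator. Hence a minimum weight exists,
   and it is bounded in terms of [n]. *)
have single (G : sgraph) : exists S : {set {set G}},
    clique_based_separator beta S /\ weight R S <= #|G|%:R * ln 2.
  have [S [tS cS SY Sx]] := clique_partition_singletons [set: G];
    rewrite cardsT in Sx.
  exists S; split=> //; split=> //; exists [set: G], [set: G]; split.
  - by split=> [|x y]; rewrite ?setUid ?setDv ?inE.
  - by rewrite /balanced setDv cards0 maxnn mulr_ge0.
  - by rewrite setIid.
have minw (G : sgraph) : exists m : R,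
    (exists S : {set {set G}},
       clique_based_separator beta S /\ weight R S <= m) /\
    (forall S : {set {set G}},
       clique_based_separator beta S -> m <= weight R S).
  have [S0 [S0P _]] := single G.
  have : `[< clique_based_separator beta S0 >] by apply/asboolP.
  move=> /(@Order.TotalTheory.arg_minP _ _ _ S0 (fun S =>
    `[< clique_based_separator beta S >]) (fun S => weight R S)).
  case=> S /asboolP SP Smin; exists (weight R S); split; first by exists S.
  by move=> S' S'P; apply: Smin; apply/asboolP.
have [m mP] := choice minw.
exists beta; split=> //.
pose A n : set R := [set x | exists G, [/\ C G, #|G| = n & x = m G]]%classic.
have Aub n : has_ubound (A n).
  exists (n%:R * ln 2) => _ [G [_ <- ->]].
  by have [S [SP]] := single G; apply: le_trans; apply: (mP G).2.
exists (fun n => sup (A n)); split; last first.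
  move=> G CG; have [[S [SP Sm]] _] := mP G; exists S; split=> //.
  by apply: le_trans Sm _; apply: ub_le_sup => //; exists G.
apply/eqoP => e e0; have [N NP] := epsP e e0.
exists N => // n /= Nn; rewrite [`|n%:R|]ger0_norm //.
(* Without any [n]-vertex graph in the class, [sup] takes its default value 0. *)
have [A0|/set0P/negP] := pselect (A n !=set0)%classic; last first.
  by rewrite negbK => /eqP ->; rewrite sup0 normr0 mulr_ge0 // ltW.
have Ae : ubound (A n) (e * n%:R).
  move=> _ [G [CG Gn ->]]; have := NP G CG; rewrite Gn => /(_ Nn)[S [SP]].
  by apply: le_trans; apply: (mP G).2.
rewrite ger0_norm; first exact: ge_sup.
have [_ [G [CG Gn _]]] := A0.
have [[S [SP Sm]] _] := mP G.
apply: (@le_trans _ _ (m G)); first exact: le_trans (weight_ge0 S) Sm.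
by apply: ub_le_sup => //; exists G.
Qed.

Theorem layered_tree_alpha_sublinear (C : graph_class) k :
  (forall G, C G -> layered_tree_alpha_le G k) ->
  sublinear_clique_based_separators R C.
Proof.
move=> Ck; apply: (@sublinear_of_eps _ (3 / 4)) => [|e e0]; first by lra.
by have [N NP] := layered_sublinear_eps k e0; exists N => G /Ck; apply: NP.
Qed.

End CliquePartitions.

(** * Comparison of the graph parameters *)

Section GraphInvariantFacts.
Variable G : sgraph.

Lemma tree_alpha_leqP k : tree_alpha G <= k <-> tree_alpha_le G k.
Proof.
rewrite /tree_alpha; case: ex_minnP => m /asboolP[T [X [XP aX]]] mmin.
split=> [mk|kP]; last by apply: mmin; apply/asboolP.
by exists T, X; split=> // t; apply: leq_trans (aX t) mk.
Qed.

Lemma layered_tree_alpha_leqP k :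
  layered_tree_alpha G <= k <-> layered_tree_alpha_le G k.
Proof.
rewrite /layered_tree_alpha; case: ex_minnP =>
  m /asboolP[T [X [l [XP lP aX]]]] mmin.
split=> [mk|kP]; last by apply: mmin; apply/asboolP.
by exists T, X, l; split=> // t i; apply: leq_trans (aX t i) mk.
Qed.

Lemma layered_tw_leqP k : layered_tw G <= k <-> layered_tw_le G k.
Proof.
rewrite /layered_tw; case: ex_minnP => m /asboolP[T [X [l [XP lP aX]]]] mmin.
split=> [mk|kP]; last by apply: mmin; apply/asboolP.
by exists T, X, l; split=> // t i; apply: leq_trans (aX t i) mk.
Qed.

Lemma layered_tw_tree_alpha k : layered_tw_le G k -> layered_tree_alpha_le G k.
Proof.
move=> [T [X [l [XP lP cX]]]]; exists T, X, l; split=> // t i.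
apply/alpha_induced_leqP => S SU _.
exact: leq_trans (subset_leq_card SU) (cX t i).
Qed.

Lemma tree_alpha_layered k : tree_alpha_le G k -> layered_tree_alpha_le G k.
Proof.
move=> [T [X [XP aX]]]; exists T, X, (fun=> 0); split=> // t i.
apply/alpha_induced_leqP => S SU; apply: (alpha_induced_leqP _ _ (aX t)).
exact: subset_trans SU (subsetIl _ _).
Qed.

Lemma alpha_tree_alpha k : alpha G <= k -> tree_alpha_le G k.
Proof.
move=> /alpha_leqP ak; exists point_graph, (fun=> [set: G]).
split=> [|t]; first exact: trivial_tree_decomposition.
by apply/alpha_induced_leqP => S _; apply: ak.
Qed.

Lemma theta_leq (P : {set {set G}}) : clique_cover P -> theta G <= #|P|.
Proof.
rewrite /theta; case: arg_minnP => [|Q _ Qmin /Qmin //].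
exact: singletons_clique_cover.
Qed.

Lemma thetaP : exists2 P : {set {set G}}, clique_cover P & #|P| = theta G.
Proof.
rewrite /theta; case: arg_minnP => [|Q QP _]; last by exists Q.
exact: singletons_clique_cover.
Qed.

Lemma theta_leq_card : theta G <= #|G|.
Proof.
apply: leq_trans (theta_leq (singletons_clique_cover G)) _.
exact: leq_imset_card.
Qed.

Lemma clique_theta_leq_alpha :
  (forall x y : G, x != y -> edge x y) -> theta G <= alpha G.
Proof.
(* The empty graph needs no clique; otherwise one clique suffices and one vertex is stable. *)
move=> cG; have [G0|/card_gt0P[x _]] := posnP #|G|.
  by rewrite (leq_trans theta_leq_card) // G0.
apply: (@leq_trans 1).
  rewrite -(cards1 [set: G]); apply: theta_leq; apply/andP; split.
    by apply/forall_inP => _ /set1P->; apply/cliqueP => y z _ _; apply: cG.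
  by rewrite /cover big_set1.
rewrite -(cards1 x); apply: stable_leq_alpha.
by apply/stableP => y z /set1P-> /set1P->; rewrite edge_irr.
Qed.

Lemma bipartite_stable (c : G -> bool) (S : {set G}) :
  (forall x y, edge x y -> c x != c y) ->
  exists S' : {set G}, [/\ S' \subset S, stable S' & #|S| <= 2 * #|S'|].
Proof.
move=> cP; pose S' b := S :&: [set x | c x == b].
have sS b : stable (S' b).
  apply/stableP => x y; rewrite !inE => /andP[_ /eqP cx] /andP[_ /eqP cy].
  by apply/negP => /cP; rewrite cx cy eqxx.
have : #|S| = #|S' true| + #|S' false|.
  rewrite -(cardsID [set x | c x == true]); congr (_ + _).
  by apply: eq_card => x; rewrite !inE andbC; case: (c x).
have [le|/ltnW le] := leqP #|S' true| #|S' false| => SE.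
  by exists (S' false); rewrite subsetIl sS; split=> //; lia.
by exists (S' true); rewrite subsetIl sS; split=> //; lia.
Qed.

End GraphInvariantFacts.

(** Singletons suffice as cliques, because one colour class holds at least half of the vertices. *)
Lemma bipartite_theta (G : sgraph) (c : G -> bool) (U : {set G}) :
  (forall x y, edge x y -> c x != c y) ->
  theta (induced_subgraph U) <= 2 * alpha (induced_subgraph U).
Proof.
move=> cP; apply: leq_trans (theta_leq_card _) _.
have [|S [_ sS le]] := @bipartite_stable (induced_subgraph U) (fun x =>
  c (val x)) [set: _].
  by move=> x y; apply: cP.
rewrite cardsT in le; apply: leq_trans le _.
by rewrite leq_mul2l stable_leq_alpha.
Qed.

Lemma linear_theta_binding (R : realType) (C : graph_class) :
  (forall G, C G -> forall U : {set G},
     theta (induced_subgraph U) <= 2 * alpha (induced_subgraph U)) ->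
  has_subquadratic_theta_binding R C.
Proof.
move=> CP; exists (fun x => (2 * x)%:R)%R; split.
  by move=> G CG U; rewrite ler_nat; apply: CP.
apply/eqoP => e e0; exists (Num.bound (2 / e)%R) => // n /= nb.
rewrite !ger0_norm ?exprn_ge0 //.
have : (2 / e <= n%:R :> R)%R.
  apply: (@le_trans _ _ (Num.bound (2 / e)%R)%:R)%R; last by rewrite ler_nat.
  by apply/ltW/archi_boundP; rewrite divr_ge0 // ltW.
rewrite ler_pdivrMr // natrM expr2 mulrA => h.
by rewrite ler_wpM2r // mulrC.
Qed.

(** * Complete graphs *)

Section CompleteGraph.

Definition complete_edge n : rel 'I_n := fun x y => x != y.

Lemma complete_sym n : symmetric (@complete_edge n).
Proof. by move=> x y; rewrite /complete_edge eq_sym. Qed.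

Lemma complete_irr n : irreflexive (@complete_edge n).
Proof. by move=> x; rewrite /complete_edge eqxx. Qed.

Definition complete n := SGraph (@complete_sym n) (@complete_irr n).

Lemma alpha_complete n : alpha (complete n) <= 1.
Proof.
apply/alpha_leqP => S /stableP sS; apply/card_le1P => x xS y.
by rewrite inE; apply/idP/eqP => [yS|->//]; apply/eqP; have := sS _ _ yS xS;
  rewrite negbK.
Qed.

(* The complement of a bag of a complete graph is connected, so a centroid bag
   has at least [n / 2] vertices; they lie in three consecutive layers. *)
Lemma layered_tw_complete n k : layered_tw_le (complete n) k -> n <= 6 * k.
Proof.
move=> [T [X [l [XP lP cX]]]]; have [t tP] := centroid_bag XP.
have nX : n <= 2 * #|X t|.
  have cn : #|complete n| = n by rewrite card_ord.
  have := cardsC (X t); have [XT|/set0Pn[v]] := eqVneq (~: X t) set0.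
    by rewrite XT cards0 cn; lia.
  rewrite inE => vX; have := tP v vX.
  have -> : component (X t) v = ~: X t.
    apply/setP => u; rewrite [in RHS]inE; apply/idP/idP => [|uX].
      exact: component_disjoint.
    rewrite inE; have [->|vu] := eqVneq v u; first exact: connect0.
    by apply: connect1; rewrite /deleted vX uX !andbT.
  by rewrite cn; lia.
have [X0|/set0Pn[v vX]] := eqVneq (X t) set0; first by move: nX;
  rewrite X0 cards0; lia.
(* If [l v = 0], the truncated predecessor is 0 again and the first two sets coincide. *)
have sub : X t \subset (X t :&: layer l (l v).-1) :|:
  (X t :&: layer l (l v)) :|: (X t :&: layer l (l v).+1).
  apply/subsetP => u uX; rewrite !inE uX /=.
  have [->|uv] := eqVneq u v; first by rewrite eqxx orbT.
  by have /andP[] := lP u v uv; lia.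
have := subset_leq_card sub.
have := (leq_card_setU (X t :&: layer l (l v).-1 :|:
  X t :&: layer l (l v)) (X t :&: layer l (l v).+1)).1.
have := (leq_card_setU (X t :&: layer l (l v).-1) (X t :&: layer l (l v))).1.
have := cX t (l v).-1; have := cX t (l v); have := cX t (l v).+1.
lia.
Qed.

End CompleteGraph.

(** * Paths and grids *)

Section Grid.

Definition path_edge n : rel 'I_n := fun i j => (i.+1 == j) || (j.+1 == i).

Lemma path_sym n : symmetric (@path_edge n).
Proof. by move=> i j; rewrite /path_edge orbC. Qed.

Lemma path_irr n : irreflexive (@path_edge n).
Proof. by move=> i; rewrite /path_edge; lia. Qed.

Definition path_graph n := SGraph (@path_sym n) (@path_irr n).

(** The relation [r] is arbitrary so that it can also be a row or column of a grid with a bag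
    deleted. *)
Lemma path_graph_connect n (r : rel 'I_n) : symmetric r ->
  (forall i j : 'I_n, i.+1 = j -> r i j) -> forall i j, connect r i j.
Proof.
move=> rS rP.
have up d (i j : 'I_n) : i + d = j -> connect r i j.
  elim: d j => [|d IHd] j ij; first by apply/eq_connect0/val_inj;
    rewrite /= -ij addn0.
  have lt : i + d < n by have := ltn_ord j; lia.
  apply: connect_trans (IHd (Ordinal lt) erefl) (connect1 _).
  by apply: rP => /=; lia.
move=> i j; have [ij|/ltnW ji] := leqP i j.
  by apply: (up (j - i)); rewrite subnKC.
by rewrite (sym_connect_sym rS); apply: (up (i - j)); rewrite subnKC.
Qed.

(* The neighbours of the largest vertex of a cycle would coincide. *)
Lemma path_graph_tree n : is_tree (path_graph n.+1).
Proof.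
split; first by rewrite card_ord.
  apply: path_graph_connect; first exact: path_sym.
  by move=> i j ij; rewrite /= /path_edge ij eqxx.
move=> c sc /andP[cyc uc].
have [m mc mmax] : exists2 m, m \in c & forall x, x \in c -> x <= m.
  case: c sc {cyc uc} => // x0 c _;
    case: (@arg_maxnP _ x0 (mem (x0 :: c)) (fun i => i : nat)).
    exact: mem_head.
  by move=> m mc mmax; exists m.
have [i p rotE] := rot_to mc.
have mem x : (x \in m :: p) = (x \in c) by rewrite -rotE mem_rot.
have := rot_uniq i c; rewrite uc rotE => um.
have : cycle (@edge (path_graph n.+1)) (m :: p) by rewrite -rotE rot_cycle.
have : 2 < size (m :: p) by rewrite -rotE size_rot.
case: p um mem {rotE} => [|x p] //; case: (lastP p) => // q y um mem _.
rewrite (cycle_path m) /= last_rcons rcons_path => /and3P[ym mx _].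
have xm : x <= m by apply: mmax; rewrite -mem !inE eqxx orbT.
have yle : y <= m by apply: mmax; rewrite -mem !inE mem_rcons mem_head !orbT.
have xy : x = y.
  by apply: val_inj => /=; move: ym mx; rewrite /= /path_edge; lia.
by move: um; rewrite xy /= mem_rcons mem_head andbF.
Qed.

Definition grid_edge n : rel ('I_n * 'I_n) := fun p q =>
  (p.1 == q.1) && path_edge p.2 q.2 || (p.2 == q.2) && path_edge p.1 q.1.

Lemma grid_sym n : symmetric (@grid_edge n).
Proof.
move=> p q; rewrite /grid_edge !(@path_sym n p.1) !(@path_sym n p.2).
by rewrite (eq_sym p.1) (eq_sym p.2).
Qed.

Lemma grid_irr n : irreflexive (@grid_edge n).
Proof. by move=> p; rewrite /grid_edge !path_irr !andbF. Qed.

Definition grid n := SGraph (@grid_sym n) (@grid_irr n).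

Definition grid_colour n (p : grid n) : bool := odd (p.1 + p.2).

Lemma grid_colourP n (p q : grid n) : edge p q ->
  grid_colour p != grid_colour q.
Proof.
case: p q => [i j] [i' j']; rewrite /grid_colour /= /grid_edge /path_edge /=.
move=> /orP[/andP[/eqP <-]|/andP[/eqP <-]] /orP[]/eqP <-;
  rewrite ?addnS ?addSn /= ?negbK; by case: (odd _).
Qed.

Lemma layered_tw_grid n : layered_tw_le (grid n.+1) 2.
Proof.
(* Rows are the layers, and bag [t] consists of columns [t] and [t.+1] (one column only for the last
   [t]). *)
pose X (t : path_graph n.+1) : {set grid n.+1} :=
  [set p : grid n.+1 | (p.2 == t :> nat) || (p.2 == t.+1 :> nat)].
exists (path_graph n.+1), X, (fun p : grid n.+1 => p.1 : nat); split.
- split; first exact: path_graph_tree.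
  + by move=> u; exists u.2; rewrite inE eqxx.
  + move=> [i j] [i' j'] /= ; rewrite /edge /= /grid_edge /path_edge /=.
    move=> /orP[/andP[/eqP <-]|/andP[/eqP <-]] H.
      by exists (if j < j' then j else j'); rewrite !inE /=; case: ltnP; lia.
    by exists j; rewrite !inE /= eqxx.
  + move=> u [t tu] [s su].
    have [st|st] := eqVneq t s; first by apply/eq_connect0/val_inj.
    apply: connect1; rewrite /= /induced_edge /= /path_edge.
    move: tu su st; rewrite !inE -!val_eqE /=; lia.
- move=> [i j] [i' j']; rewrite /edge /= /grid_edge /path_edge /=.
  by move=> /orP[/andP[/eqP <-]|/andP[_]]; lia.
move=> t i; rewrite -[2]card_bool.
have inj : {in X t :&: layer (fun p : grid n.+1 => p.1 : nat) i &,
    injective (fun p : grid n.+1 => p.2 == t :> nat)}.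
  move=> [a b] [a' b']; rewrite !inE /= => H H' E.
  by congr pair; apply: val_inj => /=; lia.
by rewrite -(card_in_imset inj) max_card.
Qed.

(* A small bag misses a column and more than half of the rows, and the union
   of these is connected. *)
Lemma tree_alpha_grid k : ~ tree_alpha_le (grid (4 * k).+1) k.
Proof.
set n := (4 * k).+1 => -[T [X [XP aX]]]; have [t tP] := centroid_bag XP.
(* The grid is bipartite, so half of the bag is stable. *)
have cX : #|X t| <= 2 * k.
  have [S [SX sS le]] := bipartite_stable (X t) (@grid_colourP n).
  by apply: leq_trans le _; rewrite leq_mul2l (alpha_induced_leqP _ _ (aX t) S).
pose rows := [set p.1 | p : grid n in X t];
  pose cols := [set p.2 | p : grid n in X t].
have rowsE : #|rows| <= 2 * k by apply: leq_trans (leq_imset_card _ _) cX.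
have colsE : #|cols| <= 2 * k by apply: leq_trans (leq_imset_card _ _) cX.
have crows : 2 * k < #|~: rows| by have := cardsC rows; rewrite card_ord; lia.
have /set0Pn[j0] : ~: cols != set0.
  by rewrite -card_gt0; have := cardsC cols; rewrite card_ord; lia.
have /set0Pn[i0] : ~: rows != set0 by rewrite -card_gt0; lia.
rewrite !inE => i0r j0c.
have row i j : i \notin rows -> (i, j) \notin X t.
  by apply: contra => ijX; apply/imsetP; exists (i, j).
have col i j : j \notin cols -> (i, j) \notin X t.
  by apply: contra => ijX; apply/imsetP; exists (i, j).
pose v0 : grid n := (i0, j0).
have inj (f : 'I_n -> grid n) : (forall i, f i \notin X t) ->
    (forall i j, path_edge i j -> edge (f i) (f j)) ->
    forall i j, connect (deleted (X t)) (f i) (f j).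
  move=> fX fE i j.
  have rS : symmetric (relpre f (deleted (X t))) by move=> a b;
    apply: deleted_sym.
  have rP (a b : 'I_n) : a.+1 = b -> relpre f (deleted (X t)) a b.
    by move=> ab; rewrite /= /deleted !fX fE // /path_edge ab eqxx.
  have /connectP[p ip ->] := path_graph_connect rS rP i j.
  by apply/connectP; exists (map f p); rewrite ?path_map ?last_map.
(* From [v0], follow the free column [j0] to row [i], then that free row. *)
have sub : setX (~: rows) [set: 'I_n] \subset component (X t) v0.
  apply/subsetP => -[i j]; rewrite !inE /= andbT => ir.
  apply: (@connect_trans _ _ (i, j0)).
    apply: (inj (fun i => (i, j0))) => [a|a b ab]; first exact: col.
    by rewrite /= /grid_edge /= eqxx ab orbT.
  apply: (inj (fun j => (i, j))) => [a|a b ab]; first exact: row.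
  by rewrite /= /grid_edge /= eqxx ab.
have := subset_leq_card sub; rewrite cardsX cardsT card_ord.
have := tP v0 (row _ _ i0r); rewrite card_prod card_ord => le1 le2.
(* More than [2 * k] of the [n = 4 * k + 1] rows are free, so they hold more than half of the
   grid. *)
have : 2 * (#|~: rows| * n) <= n * n by apply: leq_trans le1; rewrite leq_mul2l.
have nE : n = (4 * k).+1 by [].
by rewrite mulnA leq_mul2r => /orP[/eqP|]; move: nE crows; clear; lia.
Qed.

End Grid.

(** * Complements of shift graphs *)

Section ShiftGraph.

Definition shift_vertex n := {p : 'I_n * 'I_n | p.1 < p.2}.

Definition coshift_edge n : rel (shift_vertex n) := fun x y =>
  [&& x != y, (val x).2 != (val y).1 & (val y).2 != (val x).1].

Lemma coshift_sym n : symmetric (@coshift_edge n).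
Proof.
by move=> x y; rewrite /coshift_edge eq_sym; congr (_ && _); rewrite andbC.
Qed.

Lemma coshift_irr n : irreflexive (@coshift_edge n).
Proof. by move=> x; rewrite /coshift_edge eqxx. Qed.

(* The complement of the shift graph, which is triangle-free and has
   chromatic number at least [log2 n]. *)
Definition coshift n := SGraph (@coshift_sym n) (@coshift_irr n).

(** In a stable triple, any two pairs are consecutive: the upper end of one is the lower end of the
    other. A cyclic arrangement gives an increasing cycle of indices, a transitive one a pair with
    equal ends. *)
Lemma alpha_coshift n : alpha (coshift n) <= 2.
Proof.
apply/alpha_leqP => S /stableP sS; rewrite leqNgt; apply/negP => /card_gt2P.
move=> [x [y [z [[xS yS zS] [xy yz zx]]]]].
have := sS _ _ xS yS; have := sS _ _ yS zS; have := sS _ _ zS xS.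
rewrite /= /coshift_edge xy yz zx /= -!val_eqE /=.
have := valP x; have := valP y; have := valP z; rewrite /=; lia.
Qed.

(** For [i < j], a clique covering [(i, j)] is in [F i] but not in [F j], as [(i, j)] is adjacent to
    no pair with lower end [j]. So [F] injects the indices into the subsets of the cover. *)
Lemma theta_coshift n : n <= 2 ^ theta (coshift n).
Proof.
have [P /andP[/forall_inP cP /eqP covP] <-] := thetaP (coshift n).
pose F (i : 'I_n) : {set {set coshift n}} :=
  [set C in P | [exists x in C, (val x).1 == i]].
have Flt (i j : 'I_n) : i < j -> F i != F j.
  move=> ij; pose x : coshift n := exist _ (i, j) ij.
  have /bigcupP[C CP xC] : x \in cover P by rewrite covP inE.
  have Ci : C \in F i by rewrite inE CP; apply/existsP; exists x;
    rewrite xC /= eqxx.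
  apply: contraTneq Ci => ->; rewrite inE CP /=;
    apply/negP => /existsP[y /andP[yC /eqP yj]].
  have [xy|/(cliqueP _ (cP C CP) _ _ xC yC)] := eqVneq x y.
    by have := ij; rewrite -yj -xy /= ltnn.
  by rewrite /= /coshift_edge yj eqxx andbF.
have Finj : injective F.
  move=> i j Fij; apply: val_inj => /=.
  by have [/Flt|/Flt|//] := ltngtP i j; rewrite Fij eqxx.
rewrite -card_powerset -[leqLHS](card_ord n) -(card_imset _ Finj).
apply: subset_leq_card; apply/subsetP => _ /imsetP[i _ ->].
by rewrite inE; apply/subsetP => C; rewrite inE => /andP[].
Qed.

End ShiftGraph.

Lemma theta_induced_setT (G : sgraph) :
  theta G <= theta (induced_subgraph [set: G]).
Proof.
have [P /andP[/forall_inP cP /eqP covP] <-] :=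
  thetaP (induced_subgraph [set: G]).
apply: leq_trans (leq_imset_card (fun C : {set induced_subgraph [set: G]} =>
  val @: C) (mem P)).
apply: theta_leq; apply/andP; split.
  apply/forall_inP => _ /imsetP[C CP ->];
    apply/cliqueP => _ _ /imsetP[x xC ->] /imsetP[y yC ->] xy.
  by apply: (cliqueP _ (cP C CP)) => //; apply: contraNneq xy => ->.
apply/eqP/setP => x; rewrite inE; apply/bigcupP.
have /bigcupP[C CP xC] : (exist _ x (in_setT x) : induced_subgraph [set: G])
  \in cover P by rewrite covP inE.
exists (val @: C); first by apply/imsetP; exists C.
by apply/imsetP; exists (exist _ x (in_setT x)).
Qed.

(** * The classes refuting the implications *)

Section Classes.
Variable R : realType.

Definition family (F : nat -> sgraph) : graph_class :=
  fun G => exists n, G = F n.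

Lemma complete_property_a : property_a R (family complete).
Proof.
split.
  exists 1 => _ [n ->]; apply/layered_tree_alpha_leqP/tree_alpha_layered.
  exact/alpha_tree_alpha/alpha_complete.
apply: linear_theta_binding => _ [n ->] U.
apply: (@leq_trans (alpha (induced_subgraph U))); last by lia.
by apply: clique_theta_leq_alpha => x y.
Qed.

Lemma complete_property_c : property_c (family complete).
Proof.
exists 1 => _ [n ->]; apply/tree_alpha_leqP.
exact/alpha_tree_alpha/alpha_complete.
Qed.

Lemma complete_not_property_b : ~ property_b (family complete).
Proof.
move=> [k kP].
have /layered_tw_leqP/layered_tw_complete :=
  kP (complete (6 * k).+1) (ex_intro _ _ erefl).
by rewrite ltnn.
Qed.

Lemma grid_property_b : property_b (family (fun n => grid n.+1)).
Proof. by exists 2 => _ [n ->]; apply/layered_tw_leqP/layered_tw_grid. Qed.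

Lemma grid_property_a : property_a R (family (fun n => grid n.+1)).
Proof.
split.
  exists 2 => _ [n ->]; apply/layered_tree_alpha_leqP/layered_tw_tree_alpha.
  exact: layered_tw_grid.
by apply: linear_theta_binding => _ [n ->] U;
  apply: bipartite_theta (@grid_colourP _).
Qed.

Lemma grid_not_property_c : ~ property_c (family (fun n => grid n.+1)).
Proof.
move=> [k kP]; apply: (@tree_alpha_grid k); apply/tree_alpha_leqP/kP.
by exists (4 * k).
Qed.

Lemma coshift_property_c : property_c (family coshift).
Proof.
exists 2 => _ [n ->]; apply/tree_alpha_leqP.
exact/alpha_tree_alpha/alpha_coshift.
Qed.

Lemma coshift_not_property_a : ~ property_a R (family coshift).
Proof.
move=> [_ [f [fP _]]].
(* [b] exceeds [f] at the only possible independence numbers 0, 1 and 2, while the graph on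
   [2 ^ b + 1] indices needs more than [b] cliques. *)
pose b := Num.bound (`|f 0%N| + `|f 1%N| + `|f 2%N|)%R.
have fb a : a <= 2 -> (f a < b%:R)%R.
  move=> a2; apply: le_lt_trans (archi_boundP _); last by rewrite !addr_ge0.
  have n0 := normr_ge0 (f 0%N); have n1 := normr_ge0 (f 1%N).
  have n2 := normr_ge0 (f 2%N); have := ler_norm (f a).
  by move: a a2 => [|[|[|//]]] _; lra.
pose G := coshift (2 ^ b).+1.
have : (theta (induced_subgraph [set: G]) < b)%N.
  rewrite -(ltr_nat R); apply: le_lt_trans (fP G _ [set: G]) (fb _ _).
    by exists (2 ^ b).+1.
  apply/alpha_induced_leqP => S _; apply/alpha_leqP; exact: alpha_coshift.
move=> /(leq_ltn_trans (theta_induced_setT G)) /ltnW.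
rewrite -(leq_exp2l _ _ (ltnSn 1)) => /(leq_trans (theta_coshift _)).
by rewrite ltnn.
Qed.

End Classes.

Theorem proposition5p4 (R : realType) :
  (forall C : graph_class, property_a R C ->
     bounded_on layered_tree_alpha C /\ sublinear_clique_based_separators R C) /\
  (forall C : graph_class, property_b C ->
     bounded_on layered_tree_alpha C /\ sublinear_clique_based_separators R C) /\
  (forall C : graph_class, property_c C ->
     bounded_on layered_tree_alpha C /\ sublinear_clique_based_separators R C) /\
  ~ class_implies (property_a R) property_b /\
  ~ class_implies (property_a R) property_c /\
  ~ class_implies property_b property_c /\
  ~ class_implies property_c (property_a R) /\
  ~ class_implies property_c property_b.
Proof.
have sep C : bounded_on layered_tree_alpha C ->
    bounded_on layered_tree_alpha C /\ sublinear_clique_based_separators R C.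
  move=> bC; split=> //; have [k kC] := bC.
  by apply: (@layered_tree_alpha_sublinear _ _ k) =>
    G /kC/layered_tree_alpha_leqP.
split; first by move=> C [/sep].
split.
  move=> C [k kC]; apply: sep; exists k => G /kC/layered_tw_leqP.
  by move=> /layered_tw_tree_alpha/layered_tree_alpha_leqP.
split.
  move=> C [k kC]; apply: sep; exists k => G /kC/tree_alpha_leqP.
  by move=> /tree_alpha_layered/layered_tree_alpha_leqP.
split; first by move=> /(_ _ (complete_property_a R))/complete_not_property_b.
split; first by move=> /(_ _ (grid_property_a R))/grid_not_property_c.
split; first by move=> /(_ _ grid_property_b)/grid_not_property_c.
split; first by move=> /(_ _ coshift_property_c)/coshift_not_property_a.
by move=> /(_ _ complete_property_c)/complete_not_property_b.
Qed.
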